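(* Let $H$ be a real Hilbert space and $C\subset H$ a nonempty closed convex subset. Let $f_1,\dots,f_N:C\times C\to\mathbb{R}$ be bifunctions satisfying (A1)–(A4), let $A_1,\dots,A_N:C\to H$ be $\alpha$-inverse strongly monotone mappings (with a common constant $\alpha>0$), and let $S_1,\dots,S_M:C\to C$ be $\kappa$-strictly pseudocontractive mappings (with a common constant $\kappa\in[0,1)$). Suppose that the set $$F=\Big(\bigcap_{i=1}^N GEP(f_i,A_i)\Big)\cap\Big(\bigcap_{j=1}^M F(S_j)\Big)$$ is nonempty. Let $\{\alpha_n\},\{\beta_n\},\{r_n\}$ ($n\ge 0$) be real sequences such that (a) $0<\alpha_n<1$ and $\limsup_{n\to\infty}\alpha_n<1$; (b) $\kappa\le\beta_n\le b<1$ for some $b\in(\kappa,1)$; (c) $0<d\le r_n\le e<2\alpha$ for some constants $d,e$. Let $x_0\in C$, $C_0=C$, and for $n\ge0$ define $$y_n^i=T_{r_n}^{f_i}(x_n-r_nA_i x_n),\quad i=1,\dots,N,$$ $$i_n\in\arg\max\{\|y_n^i-x_n\|:1\le i\le N\},\quad \bar y_n=y_n^{i_n},$$ $$z_n^j=\alpha_nx_n+(1-\alpha_n)\big(\beta_n\bar y_n+(1-\beta_n)S_j\bar y_n\big),\quad j=1,\dots,M,$$ $$j_n\in\arg\max\{\|z_n^j-x_n\|:1\le j\le M\},\quad \bar z_n=z_n^{j_n},$$ $$C_{n+1}=\{v\in C_n:\|\bar z_n-v\|\le\|x_n-v\|\},\qquad x_{n+1}=P_{C_{n+1}}(x_0).$$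 Then the sequences $\{x_n\}$, $\{y_n^i\}$ ($i=1,\dots,N$) and $\{z_n^j\}$ ($j=1,\dots,M$) converge strongly to $P_Fx_0$.
   Context: Conditions on a bifunction $f:C\times C\to\mathbb{R}$: (A1) $f(x,x)=0$ for all $x\in C$; (A2) $f(x,y)+f(y,x)\le0$ for all $x,y\in C$; (A3) $\limsup_{t\to0^+}f(tz+(1-t)x,y)\le f(x,y)$ for all $x,y,z\in C$; (A4) for each $x\in C$, $f(x,\cdot)$ is convex and lower semicontinuous. A mapping $A:C\to H$ is $\alpha$-inverse strongly monotone ($\alpha>0$) if $\langle Ax-Ay,x-y\rangle\ge\alpha\|Ax-Ay\|^2$ for all $x,y\in C$. $GEP(f,A)$ is the set of $x\in C$ with $f(x,y)+\langle Ax,y-x\rangle\ge0$ for all $y\in C$. A mapping $S:C\to C$ is $\kappa$-strictly pseudocontractive, $\kappa\in[0,1)$, if $\|Sx-Sy\|^2\le\|x-y\|^2+\kappa\|(I-S)x-(I-S)y\|^2$ for all $x,y\in C$. $F(S)$ is the set of fixed points of $S$. For $f$ satisfying (A1)–(A4), $r>0$ and $x\in H$, $T_r^fx$ denotes the point $z\in C$ (which is known to exist and be unique) such that $f(z,y)+\frac1r\langle y-z,z-x\rangle\ge0$ for all $y\in C$. $P_D$ denotes the metric projection onto a nonempty closed convex set $D\subset H$. In the $\arg\max$ choices any maximizer may be taken. *)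

(* Defs.v *)
From HB Require Import structures.
From mathcomp Require Import all_boot all_order all_algebra.
From mathcomp Require Import all_classical all_reals all_analysis.
Import Order.TTheory GRing.Theory Num.Theory numFieldNormedType.Exports.

Set Implicit Arguments.
Unset Strict Implicit.
Unset Printing Implicit Defensive.

Local Open Scope classical_set_scope.
Local Open Scope ring_scope.

(* Maps defined on a subset C of H are represented by total functions on H; no
   definition below depends on their values at points outside C. *)

Section equilibrium.
Context {R : realType} {H : completeNormedModType R}.

(* The norm of H is the one induced by the inner product ip, so that
   H, being complete, is a real Hilbert space. *)
Definition induces_norm (ip : {dot H for (@idfun R)}) :=
  forall u : H, `|u| ^+ 2 = ip u u.

Variables (ip : {dot H for (@idfun R)}) (C : set H).

(* Lower semicontinuity is relative to C: points outside C are isolated in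
   [subspace C]. *)
Record equilibrium_bifunction (f : H -> H -> R) : Prop := {
  eqbif_diag : forall x, C x -> f x x = 0 ;
  eqbif_monotone : forall x y, C x -> C y -> f x y + f y x <= 0 ;
  eqbif_limsup : forall x y z, C x -> C y -> C z ->
    (limf_esup (fun t : R => (f (t *: z + (1 - t) *: x) y)%:E) (0^'+)
      <= (f x y)%:E)%E ;
  eqbif_convex : forall x, C x -> convex_function C (f x) ;
  eqbif_lsc : forall x, C x ->
    lower_semicontinuous (fun y : subspace C => (f x y)%:E)
}.

Definition inverse_strongly_monotone (alpha : R) (A : H -> H) :=
  forall x y, C x -> C y ->
    alpha * `|A x - A y| ^+ 2 <= ip (A x - A y) (x - y).

Definition GEP (f : H -> H -> R) (A : H -> H) : set H :=
  [set x | C x /\ forall y, C y -> 0 <= f x y + ip (A x) (y - x)].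

Definition strictly_pseudocontractive (kappa : R) (S : H -> H) :=
  set_fun C C S /\
  forall x y, C x -> C y ->
    `|S x - S y| ^+ 2 <=
      `|x - y| ^+ 2 + kappa * `|(x - S x) - (y - S y)| ^+ 2.

Definition fixed_points (S : H -> H) : set H := [set x | C x /\ S x = x].

(* [xget 0 P] is an element of P as soon as P is nonempty, and 0 otherwise. *)
Definition resolvent (f : H -> H -> R) (r : R) (x : H) : H :=
  xget 0 [set z | C z /\
    forall y, C y -> 0 <= f z y + r^-1 * ip (y - z) (z - x)].

Definition metric_projection (D : set H) (x : H) : H :=
  xget 0 [set p | D p /\ forall q, D q -> `|x - p| <= `|x - q|].

End equilibrium.

(* Main.v *)
Require Import Defs.
From HB Require Import structures.
From mathcomp Require Import all_boot all_order all_algebra.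
From mathcomp Require Import all_classical all_reals all_analysis.
From mathcomp Require Import ring lra.
Import Order.TTheory GRing.Theory Num.Theory numFieldNormedType.Exports.

(** Everything runs on quantitative convexity. A strongly convex lower
    semicontinuous function on a closed convex set attains its minimum, and it
    grows quadratically away from the minimiser
    ([strongly_convex_minimizer]). Applied to the squared distance to a point,
    this gives the metric projection together with the inequality
    |x - P x|^2 + |v - P x|^2 / 2 <= |x - v|^2 ([metric_projectionP]).

    Resolvents exist ([resolvent_exists]) without any fixed point theorem or
    weak compactness. By Minty's argument ([minty]) it suffices to find a z in
    C with phi_y(z) <= 0 for all y in C, where
    phi_y(z) = f(y, z) + <z - y, z - x> / r. Each phi_y is strongly convex in
    z, and so is each convex combination of them; monotonicity of f makes such
    a combination nonpositive at the corresponding combination of the points y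
    ([bifunction_hull_monotone]). Maximising the minimal value over all convex
    combinations then produces a common z ([strongly_convex_minimax]): strong
    convexity turns almost optimal combinations into a Cauchy sequence of
    minimisers.

    For the algorithm, let p be in F. The resolvent is firmly nonexpansive and
    A_i is inverse strongly monotone, so that
    |y_n^i - p|^2 + r_n (2 alpha - r_n) |A_i x_n - A_i p|^2
      + |y_n^i - x_n + r_n (A_i x_n - A_i p)|^2 <= |x_n - p|^2
    ([resolvent_step]); averaging with a strict pseudocontraction keeps the
    distance to p from growing ([spc_relaxed]). Hence F lies in every C_n.
    The projections of x_0 onto these decreasing closed convex sets converge to
    some q that is closest to x_0 among the points of all C_n
    ([shrinking_projections]). As x_(n+1) lies in C_(n+1), the distance from
    z_n^j to x_n is at most twice that from x_n to x_(n+1), hence tends to 0.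
    Then |x_n - p|^2 - |bar z_n - p|^2 tends to 0, and since alpha_n stays away
    from 1 so does |x_n - p|^2 - |bar y_n - p|^2. The two squares in the
    estimate above now force y_n^i - x_n to 0 ([step_displacement]), and solving
    the definition of z_n^j for S_j bar y_n forces S_j bar y_n - bar y_n to 0
    ([relaxed_displacement]). So q solves every equilibrium problem
    ([equilibrium_limit]) and is fixed by every S_j ([spc_limit]): q is in F,
    hence it is the projection of x_0 onto F. *)

Local Open Scope classical_set_scope.
Local Open Scope ring_scope.

Set Implicit Arguments.
Unset Strict Implicit.
Unset Printing Implicit Defensive.

(** * Inner product identities *)

Section inner_product.
Context {R : realType} {H : completeNormedModType R}.
Variables (ip : {dot H for (@idfun R)}) (ip_norm : induces_norm ip).

Lemma ipC u v : ip u v = ip v u.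
Proof. by have := hermC ip u v; rewrite /= expr0 mul1r. Qed.
Lemma ipDl u v w : ip (u + v) w = ip u w + ip v w.
Proof. exact: linearDl. Qed.
Lemma ipNl u w : ip (- u) w = - ip u w.
Proof. exact: linearNl. Qed.
Lemma ipZl a u w : ip (a *: u) w = a * ip u w.
Proof. exact: linearZl_LR. Qed.
Lemma ipDr u v w : ip w (u + v) = ip w u + ip w v.
Proof. by rewrite ipC ipDl !(ipC _ w). Qed.
Lemma ipNr u w : ip w (- u) = - ip w u.
Proof. by rewrite ipC ipNl (ipC _ w). Qed.
Lemma ipZr a u w : ip w (a *: u) = a * ip w u.
Proof. by rewrite ipC ipZl (ipC _ w). Qed.

Definition ipE := (ipDl, ipNl, ipZl, ipDr, ipNr, ipZr).

Lemma ip_ge0 u : 0 <= ip u u.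
Proof. by rewrite -ip_norm exprn_ge0. Qed.

(** The defect term t (1 - t) |u - v|^2 is what makes squared distances strongly
    convex with constant 1. *)
Lemma sqnorm_conv (t : R) (u v p : H) :
  `|t *: u + (1 - t) *: v - p| ^+ 2 =
  t * `|u - p| ^+ 2 + (1 - t) * `|v - p| ^+ 2 - t * (1 - t) * `|u - v| ^+ 2.
Proof.
rewrite !ip_norm !ipE (ipC v u) (ipC p u) (ipC p v); ring.
Qed.

(** Continuity of the inner product is read off from that of the norm through
    this identity. *)
Lemma polarization u v :
  ip u v = (`|u + v| ^+ 2 - `|u| ^+ 2 - `|v| ^+ 2) / 2.
Proof. by rewrite !ip_norm !ipE (ipC v u); field. Qed.

Lemma cvg_sqnorm {T} {F : set_system T} {FF : Filter F} (u : T -> H) l :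
  u @ F --> l -> (fun n => `|u n| ^+ 2) @ F --> `|l| ^+ 2.
Proof.
by move=> /cvg_norm ul; apply: (@cvg_comp _ _ _ _ (fun x => x ^+ 2) F _ _ ul);
  exact: exprn_continuous.
Qed.

Lemma cvg_ip {T} {F : set_system T} {FF : Filter F} (u v : T -> H) a b :
  u @ F --> a -> v @ F --> b -> (fun n => ip (u n) (v n)) @ F --> ip a b.
Proof.
move=> ua vb; rewrite polarization; under eq_fun do rewrite polarization.
apply: cvgM (cvg_cst _); apply: cvgB; last exact: cvg_sqnorm.
by apply: cvgB; apply: cvg_sqnorm => //; apply: cvgD.
Qed.

End inner_product.

(** * Strongly convex functions *)

Lemma combinationE (R : pzRingType) (V : lmodType R) (t : R) (u v : V) :
  t *: u + (1 - t) *: v = u + (1 - t) *: (v - u).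
Proof.
by rewrite -[t in t *: u](subKr 1) scalerBl scale1r scalerBr -addrA [- _ + _]addrC.
Qed.

Section hilbert_convexity.
Context {R : realType} {H : completeNormedModType R}.

Lemma cvg_sqr0 {T} {F : set_system T} {FF : Filter F} {V : normedModType R}
    (u : T -> V) :
  (fun n => `|u n| ^+ 2) @ F --> (0 : R) -> u @ F --> 0.
Proof.
move=> u0; apply/cvgr0Pnorm_lt => e e0.
have /cvgr0Pnorm_lt/(_ (e ^+ 2) (exprn_gt0 _ e0)) := u0.
apply: filterS => n; rewrite ger0_norm ?exprn_ge0//.
by rewrite ltr_pXn2r// nnegrE// ltW.
Qed.

Lemma cvg_sqdist (u v : nat -> H) (a : nat -> R) (l : H) :
  a @ \oo --> (0 : R) -> (\forall n \near \oo, `|u n - v n| ^+ 2 <= a n) ->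
  v @ \oo --> l -> u @ \oo --> l.
Proof.
move=> a0 uva vl; suff uv0 : (fun n => u n - v n) @ \oo --> (0 : H).
  have uE : u = (fun n => u n - v n + v n) by apply/funext => n; rewrite subrK.
  by rewrite uE -[l]add0r; exact: cvgD.
apply: cvg_sqr0; apply: squeeze_cvgr (cvg_cst 0) a0.
by apply: filterS uva => n ->; rewrite exprn_ge0.
Qed.

(** The bound splits over the two indices: a sequence of almost optimal points
    has this property as soon as the optimised quantity is strongly convex. *)
Lemma cauchy_sqdist (u : nat -> H) (a : nat -> R) :
  a @ \oo --> (0 : R) ->
  (forall m n, (m <= n)%N -> `|u m - u n| ^+ 2 <= a m + a n) ->
  exists l : H, u @ \oo --> l.
Proof.
move=> a0 ua; suff : cvg (u @ \oo) by move=> ul; exists (lim (u @ \oo)).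
apply/cauchy_cvgP/cauchyP => e e0.
have e2 : 0 < e ^+ 2 / 2 by rewrite divr_gt0// exprn_gt0.
have /cvgr0Pnorm_lt/(_ _ e2)[N _ aN] := a0.
exists (u N); exists N => // n /= Nn; rewrite -ball_normE /=.
rewrite -(@ltr_pXn2r _ 2)// ?nnegrE ?normr_ge0 ?(ltW e0)//.
apply: le_lt_trans (ua _ _ Nn) _.
have := le_lt_trans (ler_norm _) (aN _ (leqnn N)).
have := le_lt_trans (ler_norm _) (aN _ Nn); lra.
Qed.

Lemma sqdist_le0 (u v : H) : `|u - v| ^+ 2 <= 0 -> u = v.
Proof.
move=> uv0; apply/eqP; rewrite -subr_eq0 -normr_eq0.
have : `|u - v| ^+ 2 == 0 by rewrite eq_le uv0 sqr_ge0.
by rewrite expf_eq0.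
Qed.

Lemma sqnormD_le (u v : H) : `|u + v| ^+ 2 <= 2 * `|u| ^+ 2 + 2 * `|v| ^+ 2.
Proof.
have uv : `|u + v| ^+ 2 <= (`|u| + `|v|) ^+ 2.
  by rewrite ler_pXn2r ?nnegrE ?addr_ge0// ler_normD.
have := sqr_ge0 (`|u| - `|v|); lra.
Qed.

(** Convexity with a real weight, free of the bundled weights used by
    [convex_set]. *)
Definition convex_combination_closed (D : set H) :=
  forall u v (t : R), D u -> D v -> 0 <= t <= 1 -> D (t *: u + (1 - t) *: v).

Definition strongly_convex_on (D : set H) (c : R) (phi : H -> R) :=
  forall u v (t : R), D u -> D v -> 0 <= t <= 1 ->
  phi (t *: u + (1 - t) *: v) <=
    t * phi u + (1 - t) * phi v - c * (t * (1 - t) * `|u - v| ^+ 2).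

Definition lsc_on (D : set H) (phi : H -> R) :=
  forall l a, D l -> a < phi l -> \forall w \near l, D w -> a < phi w.

Lemma lsc_on_cvg D phi (u : nat -> H) (a : nat -> R) (l : H) s :
  lsc_on D phi -> (forall n, D (u n)) -> D l -> u @ \oo --> l ->
  a @ \oo --> s -> (forall n, phi (u n) <= a n) -> phi l <= s.
Proof.
move=> lsc Du Dl ul as_ ua; rewrite leNgt; apply/negP => sl.
have [m /andP[sm ml]] : exists m, s < m < phi l.
  by exists ((s + phi l) / 2); apply/andP; split; lra.
have um : \forall n \near \oo, m < phi (u n).
  have : \forall n \near \oo, D (u n) -> m < phi (u n) := ul _ (lsc _ _ Dl ml).
  by apply: filterS => n; exact.
have am : \forall n \near \oo, a n < m by exact: cvgr_lt as_ _ sm.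
have [n [mn nm]] := filter_ex (filterI um am).
have := ua n; lra.
Qed.

Lemma lsc_on_continuousD D phi (psi : H -> R) :
  lsc_on D phi -> continuous psi -> lsc_on D (fun w => phi w + psi w).
Proof.
move=> lsc psic l a Dl al; pose d := (phi l + psi l - a) / 2.
have p1 : phi l - d < phi l by rewrite /d; lra.
have p2 : psi l - d < psi l by rewrite /d; lra.
have near1 := lsc _ _ Dl p1.
have near2 : \forall w \near l, psi l - d < psi w.
  by apply: cvgr_gt p2; exact: psic.
apply: filterS2 near1 near2 => w h1 h2 Dw.
by have := h1 Dw; move: h2; rewrite /d; lra.
Qed.

(** Lower semicontinuity at z0 bounds phi below on a ball of radius r around z0.
    A farther point w, at distance s, is compared with the point of the segment
    [z0, w] on the boundary of that ball: strong convexity gives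
    phi w - phi z0 >= c s^2 - (c r + 1 / r) s, a quadratic in s bounded below. *)
Lemma strongly_convex_bounded_below D c phi : 0 < c -> D !=set0 ->
  convex_combination_closed D -> lsc_on D phi -> strongly_convex_on D c phi ->
  exists m, forall w, D w -> m <= phi w.
Proof.
move=> c0 [z0 Dz0] Dc lsc sc.
have : phi z0 - 1 < phi z0 by lra.
move/(lsc _ _ Dz0)/nbhs_ballP => [e /= e0 He].
pose r := e / 2; have r0 : 0 < r by rewrite divr_gt0.
have near_z0 w : D w -> `|w - z0| <= r -> phi z0 - 1 < phi w.
  move=> Dw wr; apply: He => //; rewrite -ball_normE/= distrC.
  by apply: le_lt_trans wr _; rewrite /r; lra.
pose K := c * r + r^-1.
exists (phi z0 - 1 - K ^+ 2 / (4 * c)) => w Dw.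
have i0 : 0 <= K ^+ 2 / (4 * c) by rewrite divr_ge0 ?sqr_ge0// mulr_ge0// ltW.
have [wr|rw] := leP `|w - z0| r; first by have := near_z0 _ Dw wr; lra.
set s := `|w - z0| in rw; pose t := r / s.
have s0 : 0 < s by lra.
have t01 : 0 <= t <= 1.
  by rewrite /t divr_ge0 ?(ltW r0) ?(ltW s0)//= ler_pdivrMr// mul1r ltW.
have ts : t * s = r by rewrite /t mulfVK// lt0r_neq0.
have tr : s * r^-1 * t = 1 by rewrite /t; field; rewrite !lt0r_neq0.
have := near_z0 _ (Dc _ _ _ Dw Dz0 t01).
have -> : t *: w + (1 - t) *: z0 - z0 = t *: (w - z0).
  by rewrite scalerBl scale1r scalerBr addrA addrAC addrK.
rewrite normrZ ger0_norm; last by case/andP: t01.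
rewrite -/s ts => /(_ (lexx _)) q1.
have := sc _ _ _ Dw Dz0 t01; rewrite -/s => q2.
(* the value at the point of the segment at distance r from z0 exceeds
   phi z0 - 1 *)
have q3 : t * (phi w - phi z0) + 1 - c * (r * s - r ^+ 2) > 0.
  have -> : r * s - r ^+ 2 = t * (1 - t) * s ^+ 2 by rewrite -ts; ring.
  by lra.
have sr0 : 0 < s * r^-1 by rewrite mulr_gt0 ?invr_gt0.
have := mulr_gt0 sr0 q3.
have -> : s * r^-1 * (t * (phi w - phi z0) + 1 - c * (r * s - r ^+ 2)) =
  phi w - phi z0 + K * s - c * s ^+ 2.
  by rewrite mulrBr mulrDr mulrA tr /K; field; exact: lt0r_neq0.
(* completing the square in s *)
have : 0 <= c * (s - K / (2 * c)) ^+ 2 by rewrite mulr_ge0 ?sqr_ge0// ltW.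
have -> : c * (s - K / (2 * c)) ^+ 2 = c * s ^+ 2 - K * s + K ^+ 2 / (4 * c).
  by field; exact: lt0r_neq0.
lra.
Qed.

(** A minimising sequence is Cauchy, because the value at the midpoint of two of
    its points cannot fall below the infimum. The quadratic growth comes from
    comparing the minimiser with its midpoint to w, which is why the constant is
    c / 2 rather than the optimal c. *)
Lemma strongly_convex_minimizer D c phi : 0 < c -> D !=set0 -> closed D ->
  convex_combination_closed D -> lsc_on D phi -> strongly_convex_on D c phi ->
  exists z, D z /\ forall w, D w -> phi z + c / 2 * `|w - z| ^+ 2 <= phi w.
Proof.
move=> c0 D0 Dcl Dc lsc sc.
have [m mphi] := strongly_convex_bounded_below c0 D0 Dc lsc sc.
have half01 : 0 <= (1 / 2 : R) <= 1 by lra.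
have midpoint u v : D u -> D v ->
    phi ((1 / 2) *: u + (1 - 1 / 2) *: v) <=
      (phi u + phi v) / 2 - c / 4 * `|u - v| ^+ 2.
  move=> Du Dv; have := sc _ _ _ Du Dv half01; lra.
have Einf : has_inf (phi @` D).
  by split; [case: D0 => v Dv; exists (phi v), v|exists m => _ [v /mphi mv <-]].
set i := inf (phi @` D).
have ile v : D v -> i <= phi v.
  by move=> Dv; apply: ge_inf; [exact: Einf.2|exists v].
have /choice[u uP] n : exists v, D v /\ phi v < i + harmonic n.
  have [_ [v Dv <-] iv] := inf_adherent (harmonic_gt0 n) Einf.
  by exists v.
have [z uz] : exists z : H, u @ \oo --> z.
  apply: (@cauchy_sqdist u (fun n => 2 / c * harmonic n)).
    rewrite -[X in _ --> X](mulr0 (2 / c)).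
    by apply: cvgM; [exact: cvg_cst|exact: cvg_harmonic].
  move=> p q _; have [[Dp up] [Dq uq]] := (uP p, uP q).
  have := ile _ (Dc _ _ _ Dp Dq half01); have := midpoint _ _ Dp Dq => h1 h2.
  have c2 : 0 < c / 2 by rewrite divr_gt0.
  rewrite -mulrDr -(ler_pM2l c2) [leRHS]mulrA.
  have -> : c / 2 * (2 / c) = 1 by field; exact: lt0r_neq0.
  lra.
have Dz : D z.
  by apply: (closed_cvg D) uz => //; apply: nearW => n; case: (uP n).
exists z; split=> // w Dw.
have zi : phi z <= i.
  apply: (lsc_on_cvg (a := fun n => i + harmonic n)) lsc _ Dz uz _ _.
  - by move=> n; case: (uP n).
  - rewrite -[X in _ --> X]addr0.
    by apply: cvgD; [exact: cvg_cst|exact: cvg_harmonic].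
  - by move=> n; apply: ltW; case: (uP n).
have := ile _ (Dc _ _ _ Dz Dw half01); have := midpoint _ _ Dz Dw.
rewrite distrC; lra.
Qed.

(** Let s be the supremum of the minimal values of the members of G; s <= 0.
    If the minimal values of phi_n tend to s then their minimisers z_n converge,
    since the average of phi_m and phi_n has minimal value at most s. The limit
    z satisfies phi z <= s for every phi in G: the minimiser v_n of
    (1 - d_n) phi_n + d_n phi stays close to z_n when d_n is small, and since
    that combination has value at most s at v_n, phi (v_n) cannot exceed s by
    more than the error of phi_n divided by d_n. Taking the error of order
    d_n^2 makes this quotient vanish. *)
Lemma strongly_convex_minimax D c (G : set (H -> R)) :
  0 < c -> D !=set0 -> closed D -> convex_combination_closed D ->
  (forall phi, G phi -> lsc_on D phi) ->
  (forall phi, G phi -> strongly_convex_on D c phi) ->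
  (forall phi psi (t : R), G phi -> G psi -> 0 <= t <= 1 ->
     G (fun z => t * phi z + (1 - t) * psi z)) ->
  (forall phi, G phi -> exists z, D z /\ phi z <= 0) ->
  exists z, D z /\ forall phi, G phi -> phi z <= 0.
Proof.
move=> c0 D0 Dcl Dc Glsc Gsc Gmix Gle0.
have [[phi0 Gphi0]|G0] := pselect (G !=set0); last first.
  by case: D0 => z Dz; exists z; split=> // phi Gphi; case: G0; exists phi.
pose is_min phi z := D z /\ forall w, D w -> phi z + c / 2 * `|w - z| ^+ 2 <= phi w.
have ex_min phi : G phi -> exists z, is_min phi z.
  by move=> Gphi; apply: strongly_convex_minimizer c0 D0 Dcl Dc _ _; auto.
pose E := [set g | exists phi z, [/\ G phi, is_min phi z & g = phi z]].
have E_le0 g : E g -> g <= 0.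
  move=> [phi [z [Gphi [_ zmin] ->]]]; have [w [Dw w0]] := Gle0 _ Gphi.
  have := zmin _ Dw; have : 0 <= c / 2 * `|w - z| ^+ 2.
    by rewrite mulr_ge0 ?sqr_ge0// divr_ge0// ltW.
  lra.
have Esup : has_sup E.
  split; last by exists 0.
  by have [z zmin] := ex_min _ Gphi0; exists (phi0 z), phi0, z.
pose s := sup E.
have s0 : s <= 0 by apply: ge_sup; [case: Esup|exact: E_le0].
have les phi z : G phi -> is_min phi z -> phi z <= s.
  by move=> Gphi zmin; apply: ub_le_sup; [case: Esup|exists phi, z].
(* halved, so that 1 - d n stays bounded away from 0 *)
pose d n : R := harmonic n / 2.
have d_gt0 n : 0 < d n by rewrite divr_gt0 ?harmonic_gt0.
have d_le n : d n <= 1 / 2.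
  by rewrite ler_pM2r// /harmonic/= invf_le1// ler1n.
have d_cvg : d @ \oo --> 0.
  rewrite -[0 in X in _ --> X](mul0r (2^-1 : R)).
  by apply: cvgM; [exact: cvg_harmonic|exact: cvg_cst].
have d2_cvg (k : R) : (fun n => k * d n) @ \oo --> 0.
  rewrite -[0 in X in _ --> X](mulr0 k).
  by apply: cvgM; [exact: cvg_cst|].
have /choice[p pP] n : exists p : (H -> R) * H,
    [/\ G p.1, is_min p.1 p.2 & s - d n ^+ 2 < p.1 p.2].
  have [_ [phi [z [Gphi zmin ->]]] sz] :=
    sup_adherent (exprn_gt0 2 (d_gt0 n)) Esup.
  by exists (phi, z).
have [z uz] : exists z : H, (fun n => (p n).2) @ \oo --> z.
  apply: (@cauchy_sqdist _ (fun n => 8 / c * d n)) => // m n _.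
  have [Gm [Dm minm] sm] := pP m; have [Gn [Dn minn] sn] := pP n.
  have half01 : 0 <= (1 / 2 : R) <= 1 by lra.
  have Gmid := Gmix _ _ _ Gm Gn half01.
  have [w wmin] := ex_min _ Gmid.
  have /= ws := les _ _ Gmid wmin.
  have wm := minm _ wmin.1; have wn := minn _ wmin.1.
  have dd k : d k ^+ 2 <= d k.
    by have := d_gt0 k; have := d_le k; move=> ? ?; rewrite expr2; nra.
  have tri : `|(p m).2 - (p n).2| ^+ 2 <=
      2 * `|w - (p m).2| ^+ 2 + 2 * `|w - (p n).2| ^+ 2.
    have := sqnormD_le ((p m).2 - w) (w - (p n).2).
    by rewrite addrA subrK (distrC _ w).
  have c8 : 0 < c / 8 by rewrite divr_gt0.
  rewrite -mulrDr -(ler_pM2l c8) [leRHS]mulrA.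
  have -> : c / 8 * (8 / c) = 1 by field; exact: lt0r_neq0.
  have := ler_wpM2l (ltW c8) tri; have := dd m; have := dd n.
  have := d_gt0 m; have := d_gt0 n; lra.
have Dz : D z.
  by apply: (closed_cvg D) uz => //; apply: nearW => n; case: (pP n) => _ [].
exists z; split=> // phi Gphi; apply: le_trans s0.
have [z0 [Dz0 phimin]] := ex_min _ Gphi; set m := phi z0 in phimin.
have m_le w : D w -> m <= phi w.
  move=> Dw; have := phimin _ Dw; have : 0 <= c / 2 * `|w - z0| ^+ 2.
    by rewrite mulr_ge0 ?sqr_ge0// divr_ge0// ltW.
  lra.
have /choice[v vP] n : exists v, [/\ D v, phi v <= s + d n &
    `|v - (p n).2| ^+ 2 <= 4 / c * (s - m + 1) * d n].
  have [Gn [Dn minn] sn] := pP n.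
  have d01 : 0 <= d n <= 1 by have := d_gt0 n; have := d_le n; lra.
  have Gn' := Gmix _ _ _ Gphi Gn d01.
  have [v vmin] := ex_min _ Gn'; exists v.
  have /= vs := les _ _ Gn' vmin; have vn := minn _ vmin.1; have vm := m_le _ vmin.1.
  set X := `|v - (p n).2| ^+ 2 in vn *.
  have X0 : 0 <= X by exact: sqr_ge0.
  have dn0 := d_gt0 n; have dn1 := d_le n; set e := d n in dn0 dn1 sn vs *.
  have key : e * phi v + (1 - e) * (s - e ^+ 2 + c / 2 * X) <= s.
    by apply: le_trans vs; rewrite lerD2l ler_pM2l; lra.
  have cX0 : 0 <= c / 2 * X by rewrite mulr_ge0// divr_ge0// ltW.
  split; first by case: vmin.
    by rewrite -(ler_pM2l dn0); nra.
  have c4 : 0 < c / 4 by rewrite divr_gt0.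
  rewrite -(ler_pM2l c4).
  have -> : c / 4 * (4 / c * (s - m + 1) * e) = (s - m + 1) * e.
    by field; exact: lt0r_neq0.
  have : (1 - e) * (c / 2 * X) <= e * (s - m + e) by nra.
  nra.
have vz : v @ \oo --> z.
  apply: cvg_sqdist (d2_cvg (4 / c * (s - m + 1))) _ uz.
  by apply: nearW => n; case: (vP n).
apply: (lsc_on_cvg (a := fun n => s + d n)) (Glsc _ Gphi) _ Dz vz _ _.
- by move=> n; case: (vP n).
- by rewrite -[s in X in _ --> X]addr0; exact: cvgD (cvg_cst s) d_cvg.
- by move=> n; case: (vP n).
Qed.

End hilbert_convexity.

(** * Resolvents of equilibrium problems *)

Section equilibrium_problems.
Context {R : realType} {H : completeNormedModType R}.
Variables (ip : {dot H for (@idfun R)}) (ip_norm : induces_norm ip).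
Variable C : set H.
Hypotheses (C_neq0 : C !=set0) (C_closed : closed C) (C_convex : convex_set C).

Lemma convex_set_combination : convex_combination_closed C.
Proof.
move=> u v t Cu Cv /andP[t0 t1].
by have /(_ (Itv01 t0 t1)) := C_convex _ (mem_set Cu) (mem_set Cv); rewrite inE.
Qed.

Lemma convex_functionE g : convex_function C g ->
  forall u v (t : R), C u -> C v -> 0 <= t <= 1 ->
  g (t *: u + (1 - t) *: v) <= t * g u + (1 - t) * g v.
Proof.
move=> gc u v t Cu Cv /andP[t0 t1].
exact: gc (Itv01 t0 t1) _ _ (mem_set Cu) (mem_set Cv).
Qed.

Lemma lower_semicontinuous_lsc_on (g : H -> R) :
  lower_semicontinuous (fun y : subspace C => (g y)%:E) -> lsc_on C g.
Proof.
move=> glsc l a Cl al.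
have /glsc[V lV Va] : (a%:E < (g (l : subspace C))%:E)%E by rewrite lte_fin.
move: lV; rewrite -[nbhs _]/(nbhs_subspace _) -nbhs_subspace_in// => lV.
have {}lV : \forall w \near l, C w -> V w := lV.
by apply: filterS lV => w Vw Cw; rewrite -lte_fin; exact: Va (Vw Cw).
Qed.

Variable f : H -> H -> R.
Hypothesis f_eq : equilibrium_bifunction C f.

(** The inequality at the point v = t y + (1 - t) z together with 0 = f(v, v)
    and convexity of f(v, .) gives 0 <= f(v, y) + (1 - t) <w, y - z>; the upper
    hemicontinuity of f in its first argument lets t tend to 0. *)
Lemma minty z w : C z -> (forall y, C y -> f y z <= ip w (y - z)) ->
  forall y, C y -> 0 <= f z y + ip w (y - z).
Proof.
move=> Cz zP y Cy; rewrite leNgt; apply/negP; set k := ip w (y - z) => lt0.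
have seg (t : R) : 0 < t <= 1 ->
    0 <= f (t *: y + (1 - t) *: z) y + (1 - t) * k.
  move=> /andP[t0 t1]; set v := t *: y + (1 - t) *: z.
  have t01 : 0 <= t <= 1 by rewrite ltW.
  have Cv : C v by exact: convex_set_combination.
  have := convex_functionE (eqbif_convex f_eq Cv) Cy Cz t01.
  rewrite -/v (eqbif_diag f_eq Cv).
  have := zP _ Cv.
  have -> : v - z = t *: (y - z).
    by rewrite /v scalerBl scale1r scalerBr addrA addrAC addrK.
  rewrite ipZr -/k => h1 h2; rewrite -(ler_pM2l t0) mulr0.
  have := ler_wpM2l (_ : 0 <= 1 - t) h1; lra.
have [a /andP[fa ak]] : exists a, f z y < a < - k.
  by exists ((f z y - k) / 2); apply/andP; split; lra.
have : (limf_esup (fun t : R => (f (t *: y + (1 - t) *: z) y)%:E) 0^'+ < a%:E)%E.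
  by apply: le_lt_trans (eqbif_limsup f_eq Cz Cy Cy) _; rewrite lte_fin.
rewrite limf_esupE => /ereal_inf_lt[_ [V V0 <-] Va].
have near_a : \forall t \near (0 : R)^'+, f (t *: y + (1 - t) *: z) y < a.
  apply: filterS V0 => t Vt; rewrite -lte_fin; apply: le_lt_trans Va.
  by apply: ereal_sup_ubound; exists t.
have k1 : 0 < 1 + `|k| by rewrite ltr_pwDl.
(* below this threshold a + (1 - t) * k is negative *)
have e0 : 0 < Num.min 1 ((- k - a) / (1 + `|k|)).
  by rewrite lt_min ltr01 divr_gt0//; lra.
have near_e : \forall t \near (0 : R)^'+, t < Num.min 1 ((- k - a) / (1 + `|k|)).
  exact: nbhs_right_lt.
have [t [[ta te] tgt0]] := filter_ex (filterI (filterI near_a near_e) (nbhs_right_gt 0)).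
move: te; rewrite lt_min ltr_pdivlMr// => /andP[t1 te].
have := seg t; rewrite tgt0 ltW// => /(_ isT).
have := ler_norm (- k); rewrite normrN => kk.
nra.
Qed.

(** The convex hull of the pairs (f y, y), for y in C, in functions times points.
    Keeping the barycenter next to the function is what allows monotonicity of f
    to be extended from points to convex combinations. *)
Inductive bifunction_hull : (H -> R) -> H -> Prop :=
| hull_point y : C y -> bifunction_hull (f y) y
| hull_mix (t : R) g v h w : 0 <= t <= 1 ->
    bifunction_hull g v -> bifunction_hull h w ->
    bifunction_hull (fun z => t * g z + (1 - t) * h z) (t *: v + (1 - t) *: w).

Lemma bifunction_hull_regular g v : bifunction_hull g v ->
  [/\ C v, lsc_on C g &
      forall a b (t : R), C a -> C b -> 0 <= t <= 1 ->
        g (t *: a + (1 - t) *: b) <= t * g a + (1 - t) * g b].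
Proof.
elim=> {g v}[y Cy|t g v h w t01 _ [Cv glsc gc] _ [Cw hlsc hc]].
  split=> //; first exact/lower_semicontinuous_lsc_on/(eqbif_lsc f_eq Cy).
  exact/convex_functionE/(eqbif_convex f_eq Cy).
split; first exact: convex_set_combination.
  move=> l a Cl al; pose e := (t * g l + (1 - t) * h l - a) / 2.
  have p1 : g l - e < g l by rewrite /e; lra.
  have p2 : h l - e < h l by rewrite /e; lra.
  apply: filterS2 (glsc _ _ Cl p1) (hlsc _ _ Cl p2) => x h1 h2 Cx.
  have [t0 t1] := andP t01.
  have gx : 0 <= t * (g x - (g l - e)) by rewrite mulr_ge0// subr_ge0 ltW// h1.
  have hx : 0 <= (1 - t) * (h x - (h l - e)).
    by rewrite mulr_ge0 ?subr_ge0// ltW// h2.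
  by rewrite /e in gx hx; lra.
move=> a b s Ca Cb s01; have := gc _ _ _ Ca Cb s01; have := hc _ _ _ Ca Cb s01.
have [t0 t1] := andP t01; move=> hs gs.
have := ler_wpM2l t0 gs; have := ler_wpM2l (_ : 0 <= 1 - t) hs.
by rewrite subr_ge0 => /(_ t1); lra.
Qed.

(** For two pairs (f y, y) this is monotonicity of f. It passes to combinations
    in one argument at a time: the left side is affine in the function that is
    combined and convex in its barycenter. *)
Lemma bifunction_hull_monotone g v h w :
  bifunction_hull g v -> bifunction_hull h w -> g w + h v <= 0.
Proof.
have base y k u : C y -> bifunction_hull k u -> f y u + k y <= 0.
  move=> Cy; elim=> {k u}[x Cx|t k u l x t01 ku IHk lx IHl].
    exact: (eqbif_monotone f_eq Cy Cx).
  have [Cu _ _] := bifunction_hull_regular ku.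
  have [Cx _ _] := bifunction_hull_regular lx.
  have := convex_functionE (eqbif_convex f_eq Cy) Cu Cx t01; nra.
move=> gv; elim: gv h w => {g v}[y Cy|t g v k x t01 gv IHg kx IHk] h w hw.
  exact: base.
have [Cv _ _] := bifunction_hull_regular gv.
have [Cx _ _] := bifunction_hull_regular kx.
have [_ _ hc] := bifunction_hull_regular hw.
have := hc _ _ _ Cv Cx t01; have := IHg _ _ hw; have := IHk _ _ hw; nra.
Qed.

(** With (g, v) in the hull, z |-> g z + <z - v, z - x> / r depends affinely on
    (g, v), is strongly convex with constant 1 / r, and at z = v equals
    g v <= 0. The minimax lemma yields a z at which all of them are nonpositive,
    in particular those with (g, v) = (f y, y), and [minty] turns this into the
    equilibrium inequality. *)
Lemma resolvent_exists (r : R) (x : H) : 0 < r ->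
  exists z, C z /\ forall y, C y -> 0 <= f z y + r^-1 * ip (y - z) (z - x).
Proof.
move=> r0; have ri0 : 0 < r^-1 by rewrite invr_gt0.
pose G := [set phi | exists g v, bifunction_hull g v /\
  phi = fun z => g z + r^-1 * ip (z - v) (z - x)].
have [||||z [Cz zP]] := strongly_convex_minimax (G := G) ri0 C_neq0 C_closed
  convex_set_combination.
- move=> _ [g [v [gv ->]]]; have [_ glsc _] := bifunction_hull_regular gv.
  apply: lsc_on_continuousD => // z; apply: cvgM; first exact: cvg_cst.
  by apply: cvg_ip => //; apply: cvgB => //; exact: cvg_cst.
- move=> _ [g [v [gv ->]]]; have [_ _ gc] := bifunction_hull_regular gv.
  move=> a b t Ca Cb t01; have := gc _ _ _ Ca Cb t01.
  have -> : ip (t *: a + (1 - t) *: b - v) (t *: a + (1 - t) *: b - x) =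
    t * ip (a - v) (a - x) + (1 - t) * ip (b - v) (b - x) -
    t * (1 - t) * `|a - b| ^+ 2.
    rewrite ip_norm !ipE (ipC ip b a) (ipC ip v a) (ipC ip v b); ring.
  lra.
- move=> _ _ t [g [v [gv ->]]] [h [w [hw ->]]] t01.
  exists (fun z => t * g z + (1 - t) * h z), (t *: v + (1 - t) *: w).
  split; first exact: hull_mix.
  by apply/funext => z; rewrite !ipE; ring.
- move=> _ [g [v [gv ->]]]; have [Cv _ _] := bifunction_hull_regular gv.
  exists v; split=> //; rewrite subrr ipC.
  have := bifunction_hull_monotone gv gv.
  by rewrite (_ : ip _ 0 = 0) ?mulr0 ?addr0; [lra|rewrite -(scale0r 0) ipZr mul0r].
exists z; split=> // y Cy.
rewrite ipC -ipZl; apply: minty Cz _ _ Cy => {}y {}Cy; rewrite ipZl.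
have Gy : G (fun z => f y z + r^-1 * ip (z - y) (z - x)).
  by exists (f y), y; split=> //; exact: hull_point.
have := zP _ Gy; have -> : ip (z - y) (z - x) = - ip (z - x) (y - z).
  by rewrite ipC -[z - y]opprB ipNr.
by rewrite mulrN subr_le0.
Qed.

Lemma resolventP (r : R) (x : H) : 0 < r ->
  C (resolvent ip C f r x) /\
  forall y, C y -> 0 <= f (resolvent ip C f r x) y +
    r^-1 * ip (y - resolvent ip C f r x) (resolvent ip C f r x - x).
Proof. by move=> r0; exact: (xgetPex 0 (resolvent_exists x r0)). Qed.

End equilibrium_problems.

(** * Metric projections and shrinking sets *)

Section projections.
Context {R : realType} {H : completeNormedModType R}.
Variables (ip : {dot H for (@idfun R)}) (ip_norm : induces_norm ip).

(** The quadratic gap makes the nearest point unique, so it is the value chosen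
    by [metric_projection]. *)
Lemma metric_projection_eq (D : set H) x p : D p ->
  (forall v, D v -> `|x - p| ^+ 2 + 1 / 2 * `|v - p| ^+ 2 <= `|x - v| ^+ 2) ->
  metric_projection D x = p.
Proof.
move=> Dp pP.
have : exists p, D p /\ forall q, D q -> `|x - p| <= `|x - q|.
  exists p; split=> // v Dv; rewrite -(@ler_pXn2r _ 2) ?nnegrE//.
  by apply: le_trans (pP _ Dv); rewrite lerDl mulr_ge0 ?sqr_ge0.
move=> /(xgetPex 0); rewrite -[xget _ _]/(metric_projection D x) => -[Dq qmin].
apply: sqdist_le0; have := pP _ Dq; have := qmin _ Dp.
by rewrite -(@ler_pXn2r _ 2) ?nnegrE// => h1 h2; lra.
Qed.

Lemma metric_projectionP (D : set H) x : D !=set0 -> closed D ->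
  convex_combination_closed D ->
  D (metric_projection D x) /\ forall v, D v ->
    `|x - metric_projection D x| ^+ 2 +
      1 / 2 * `|v - metric_projection D x| ^+ 2 <= `|x - v| ^+ 2.
Proof.
move=> D0 Dcl Dc.
have sqdist_lsc : lsc_on D (fun v => `|x - v| ^+ 2).
  move=> l a Dl al.
  have : \forall v \near l, a < `|x - v| ^+ 2.
    apply: cvgr_gt al; apply: cvg_sqnorm.
    by apply: cvgB; [exact: cvg_cst|exact: cvg_id].
  by apply: filterS.
have sqdist_sc : strongly_convex_on D 1 (fun v => `|x - v| ^+ 2).
  by move=> u v t _ _ _; rewrite !(distrC x) (sqnorm_conv ip_norm) mul1r.
have [p [Dp pP]] := strongly_convex_minimizer ltr01 D0 Dcl Dc sqdist_lsc sqdist_sc.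
by rewrite (metric_projection_eq Dp pP).
Qed.

Lemma metric_projection_id (D : set H) x : D x -> metric_projection D x = x.
Proof.
move=> Dx; apply: metric_projection_eq => // v _.
rewrite subrr normr0 expr0n/= add0r distrC; have := sqr_ge0 `|x - v|; lra.
Qed.

(** Convexity: the terms quadratic in v cancel in |z - v|^2 <= |x - v|^2. *)
Lemma closer_half_space (D : set H) z x : closed D ->
  convex_combination_closed D ->
  let D' := [set v | D v /\ `|z - v| <= `|x - v|] in
  closed D' /\ convex_combination_closed D'.
Proof.
move=> Dcl Dc D'; split.
  have -> : D' = D `&` [set v | `|z - v| - `|x - v| <= 0].
    by apply/seteqP; split=> v /=; rewrite subr_le0.
  apply: closedI => //.
  apply: (@preimage_closed _ _ (fun v => `|z - v| - `|x - v|) [set r | r <= 0]).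
    move=> v _; apply: cvgB; apply: cvg_norm; apply: cvgB;
      by [exact: cvg_cst|exact: cvg_id].
  exact: closed_le.
move=> u v t [Du zu] [Dv zv] t01; split; first exact: Dc.
have [t0 t1] := andP t01; move: zu zv.
have sqE (a b : H) : (`|a| <= `|b|) = (`|a| ^+ 2 <= `|b| ^+ 2).
  by rewrite ler_pXn2r ?nnegrE.
rewrite !(distrC z) !(distrC x) !sqE !(sqnorm_conv ip_norm) => zu zv.
have := ler_wpM2l t0 zu; have := ler_wpM2l (_ : 0 <= 1 - t) zv.
rewrite subr_ge0 => /(_ t1); lra.
Qed.

(** For m <= n the point x n belongs to D m, so the projection inequality gives
    |x0 - x m|^2 + |x n - x m|^2 / 2 <= |x0 - x n|^2. The distances to x0 are
    therefore nondecreasing, and bounded by the distance from x0 to a common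
    point, whence x is Cauchy. *)
Lemma shrinking_projections (D : nat -> set H) (x0 : H) (x : nat -> H) :
  (forall n, closed (D n)) -> (forall n, convex_combination_closed (D n)) ->
  (forall n, D n.+1 `<=` D n) -> (exists p, forall n, D n p) ->
  (forall n, x n = metric_projection (D n) x0) ->
  exists q : H, [/\ x @ \oo --> q &
    forall p, (forall n, D n p) ->
      `|x0 - q| ^+ 2 + 1 / 2 * `|p - q| ^+ 2 <= `|x0 - p| ^+ 2].
Proof.
move=> Dcl Dc Dsub [p0 Dp0] xE.
have Dmono m n : (m <= n)%N -> D n `<=` D m.
  move=> mn; rewrite -(subnK mn); elim: (n - m)%N => [|k IH]; first by rewrite add0n.
  by rewrite addSn => v /Dsub; exact: IH.
have xP n : D n (x n) /\ forall v, D n v ->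
    `|x0 - x n| ^+ 2 + 1 / 2 * `|v - x n| ^+ 2 <= `|x0 - v| ^+ 2.
  by rewrite xE; apply: metric_projectionP => //; exists p0; exact: Dp0.
pose a n := `|x0 - x n| ^+ 2.
have aD m n : (m <= n)%N -> a m + 1 / 2 * `|x n - x m| ^+ 2 <= a n.
  by move=> mn; apply: (xP m).2; apply: Dmono mn _ (xP n).1.
have a_nd : {homo a : m n / (m <= n)%N >-> m <= n}.
  move=> m n /aD; apply: le_trans; rewrite lerDl mulr_ge0 ?sqr_ge0//.
have a_ub : has_ubound (range a).
  exists (`|x0 - p0| ^+ 2) => _ [n _ <-]; apply: le_trans ((xP n).2 _ (Dp0 n)).
  by rewrite lerDl mulr_ge0 ?sqr_ge0.
set L := sup (range a).
have aL : a @ \oo --> L := nondecreasing_cvgn a_nd a_ub.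
have a_le n : a n <= L by apply: ub_le_sup => //; exists n.
have [q xq] : exists q : H, x @ \oo --> q.
  apply: (@cauchy_sqdist _ _ _ (fun n => 2 * (L - a n))).
    rewrite -[0 in X in _ --> X](mulr0 2) -(subrr L).
    apply: cvgM; first exact: cvg_cst.
    by apply: cvgB => //; exact: cvg_cst.
  by move=> m n mn; have := aD _ _ mn; have := a_le n; rewrite distrC; lra.
exists q; split=> // p Dp.
apply: (@ler_cvg_to _ \oo _ R (fun n => `|x0 - x n| ^+ 2 + 1 / 2 * `|p - x n| ^+ 2)
  (fun=> `|x0 - p| ^+ 2)).
- apply: cvgD; first by apply: cvg_sqnorm; apply: cvgB => //; exact: cvg_cst.
  apply: cvgM; first exact: cvg_cst.
  by apply: cvg_sqnorm; apply: cvgB => //; exact: cvg_cst.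
- exact: cvg_cst.
- by apply: nearW => n; apply: (xP n).2.
Qed.

End projections.

(** * Estimates for one step and closedness of the solution sets *)

Section limits_of_solutions.
Context {R : realType} {H : completeNormedModType R}.
Variables (ip : {dot H for (@idfun R)}) (ip_norm : induces_norm ip).
Variable C : set H.
Hypotheses (C_neq0 : C !=set0) (C_closed : closed C) (C_convex : convex_set C).

(** The inequality at u n involves f in its first argument, where f is not
    semicontinuous in general. Monotonicity moves u n to the second argument,
    lower semicontinuity passes to the limit there, and [minty] moves back. *)
Lemma equilibrium_limit f (u w : nat -> H) q w' :
  equilibrium_bifunction C f ->
  (forall n, C (u n)) -> u @ \oo --> q -> w @ \oo --> w' ->
  (forall n y, C y -> 0 <= f (u n) y + ip (w n) (y - u n)) ->
  forall y, C y -> 0 <= f q y + ip w' (y - q).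
Proof.
move=> f_eq Cu uq ww uP.
have Cq : C q by apply: (closed_cvg C) uq => //; exact: nearW.
apply: (minty C_convex f_eq) => // y Cy.
apply: (lsc_on_cvg (D := C) (a := fun n => ip (w n) (y - u n)) _ Cu Cq uq).
- exact/lower_semicontinuous_lsc_on/(eqbif_lsc f_eq Cy).
- by apply: cvg_ip => //; apply: cvgB => //; exact: cvg_cst.
- move=> n; have := eqbif_monotone f_eq Cy (Cu n); have := uP n _ Cy; lra.
Qed.

(** The defining inequality at (u n, q) becomes
    |q - S q|^2 <= kappa |q - S q|^2 in the limit. *)
Lemma spc_limit (kappa : R) S (u : nat -> H) q :
  kappa < 1 -> strictly_pseudocontractive C kappa S ->
  (forall n, C (u n)) -> u @ \oo --> q -> (fun n => S (u n)) @ \oo --> q ->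
  fixed_points C S q.
Proof.
move=> k1 [_ Sspc] Cu uq Suq.
have Cq : C q by apply: (closed_cvg C) uq => //; exact: nearW.
split=> //; have : `|q - S q| ^+ 2 <= `|q - q| ^+ 2 +
    kappa * `|(q - q) - (q - S q)| ^+ 2.
  apply: (@ler_cvg_to _ \oo _ R (fun n => `|S (u n) - S q| ^+ 2)
    (fun n => `|u n - q| ^+ 2 + kappa * `|(u n - S (u n)) - (q - S q)| ^+ 2)).
  - by apply: cvg_sqnorm; apply: cvgB => //; exact: cvg_cst.
  - apply: cvgD; first by apply: cvg_sqnorm; apply: cvgB => //; exact: cvg_cst.
    apply: cvgM; first exact: cvg_cst.
    apply: cvg_sqnorm; apply: cvgB; last exact: cvg_cst.
    exact: cvgB.
  - by apply: nearW => n; exact: Sspc.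
rewrite subrr normr0 expr0n/= sub0r normrN add0r => h.
by apply/esym/sqdist_le0; nra.
Qed.

(** Expand 0 <= |alpha (A u - A v) - (u - v)|^2. *)
Lemma ism_lipschitz alpha A u v : 0 < alpha ->
  inverse_strongly_monotone ip C alpha A -> C u -> C v ->
  `|A u - A v| ^+ 2 <= alpha ^- 2 * `|u - v| ^+ 2.
Proof.
move=> a0 Aism Cu Cv; rewrite mulrC ler_pdivlMr ?exprn_gt0//.
have := ip_ge0 ip_norm (alpha *: (A u - A v) - (u - v)).
have := ler_wpM2l (ltW a0) (Aism _ _ Cu Cv).
move: (A u - A v) (u - v) => D e.
by rewrite !ip_norm !ipE (ipC ip e D); lra.
Qed.

(** The defect beta (1 - beta) |u - S u|^2 of the convex combination absorbs the
    excess (1 - beta) kappa |u - S u|^2 allowed to S. *)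
Lemma spc_relaxed (kappa beta : R) S p u :
  kappa <= beta <= 1 -> strictly_pseudocontractive C kappa S ->
  fixed_points C S p -> C u ->
  `|beta *: u + (1 - beta) *: S u - p| ^+ 2 <= `|u - p| ^+ 2.
Proof.
move=> /andP[kb b1] [_ Sspc] [Cp Sp] Cu; rewrite (sqnorm_conv ip_norm).
have := Sspc _ _ Cu Cp; rewrite Sp subrr subr0 => h.
have b0 : 0 <= 1 - beta by rewrite subr_ge0.
have := ler_wpM2l b0 h.
have : 0 <= (1 - beta) * ((beta - kappa) * `|u - S u| ^+ 2).
  by rewrite mulr_ge0// mulr_ge0 ?sqr_ge0// subr_ge0.
lra.
Qed.

(** A solution p is the resolvent of p - r A p. Adding the inequalities for y
    and p and using monotonicity of f gives <y - p, y - x + r (A x - A p)> <= 0,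
    which after expansion of the squares is firm nonexpansiveness of the
    resolvent; inverse strong monotonicity bounds
    |x - p - r (A x - A p)|^2. *)
Lemma resolvent_step f A (alpha r : R) x p y :
  equilibrium_bifunction C f -> inverse_strongly_monotone ip C alpha A ->
  0 < r -> C x -> GEP ip C f A p ->
  y = resolvent ip C f r (x - r *: A x) ->
  `|y - p| ^+ 2 + r * (2 * alpha - r) * `|A x - A p| ^+ 2 +
    `|y - x + r *: (A x - A p)| ^+ 2 <= `|x - p| ^+ 2.
Proof.
move=> f_eq Aism r0 Cx [Cp pP] yE.
have [Cy yP] := resolventP ip_norm C_neq0 C_closed C_convex f_eq (x - r *: A x) r0.
rewrite -yE in Cy yP.
have := yP _ Cp; have := pP _ Cy; have := eqbif_monotone f_eq Cp Cy.
move=> h1 h2 h3; have := Aism _ _ Cx Cp => h4.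
have h5 : 0 <= r * ip (A p) (y - p) + ip (p - y) (y - (x - r *: A x)).
  have -> : ip (p - y) (y - (x - r *: A x)) =
      r * (r^-1 * ip (p - y) (y - (x - r *: A x))).
    by rewrite mulrA mulfV ?mul1r// lt0r_neq0.
  by rewrite -mulrDr mulr_ge0 ?(ltW r0)//; lra.
move: h5 (ler_wpM2l (ltW r0) h4).
rewrite !ip_norm !ipE (ipC ip p y) (ipC ip x y) (ipC ip p x) (ipC ip (A x) (A p)).
rewrite !(ipC ip (A _) y) !(ipC ip (A _) x) !(ipC ip (A _) p).
lra.
Qed.

(** Split u - v as the sum of u - v + r D and - r D. *)
Lemma step_displacement (m e r E : R) (u v D : H) : 0 < m -> 0 <= r <= e ->
  m * `|D| ^+ 2 + `|u - v + r *: D| ^+ 2 <= E ->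
  `|u - v| ^+ 2 <= (2 + 2 * e ^+ 2 / m) * E.
Proof.
move=> m0 /andP[r0 re] mE.
have B0 := sqr_ge0 `|u - v + r *: D|.
have mD0 := mulr_ge0 (ltW m0) (sqr_ge0 `|D|).
have hD : `|D| ^+ 2 <= E / m by rewrite ler_pdivlMr// mulrC; lra.
have hrD : `|r *: D| ^+ 2 <= e ^+ 2 * (E / m).
  rewrite normrZ exprMn ler_pM ?sqr_ge0//.
  by rewrite ler_pXn2r ?nnegrE ?(le_trans r0 re)// ger0_norm.
have := sqnormD_le (u - v + r *: D) (- (r *: D)).
rewrite addrK normrN; lra.
Qed.

(** From the definition of z,
    (1 - s) (1 - t) (w - u) = (z - x) - (1 - s) (u - x), and the factor on the
    left is at least (1 - a) (1 - b) > 0. *)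
Lemma relaxed_displacement (a b s t : R) (x u w z : H) :
  s <= a < 1 -> 0 <= s -> t <= b < 1 ->
  z = s *: x + (1 - s) *: (t *: u + (1 - t) *: w) ->
  `|w - u| ^+ 2 <=
    ((1 - a) * (1 - b)) ^- 2 * (2 * `|z - x| ^+ 2 + 2 * `|u - x| ^+ 2).
Proof.
move=> /andP[sa a1] s0 /andP[tb b1] zE.
have ab : 0 < (1 - a) * (1 - b) by apply: mulr_gt0; lra.
rewrite mulrC ler_pdivlMr ?exprn_gt0//.
have wE : ((1 - s) * (1 - t)) *: (w - u) = (z - x) + - ((1 - s) *: (u - x)).
  rewrite zE !combinationE [x + _]addrC addrK -scalerN -scalerDr.
  by rewrite -scalerA opprB addrA subrK [u + _]addrC addrK.
have := sqnormD_le (z - x) (- ((1 - s) *: (u - x))).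
rewrite -wE normrN !normrZ !exprMn !real_normK ?num_real// => h.
have h0 : (1 - a) * (1 - b) <= (1 - s) * (1 - t) by apply: ler_pM; lra.
have h1 : ((1 - a) * (1 - b)) ^+ 2 <= ((1 - s) * (1 - t)) ^+ 2.
  by rewrite ler_pXn2r ?nnegrE ?(ltW ab) ?(le_trans (ltW ab) h0).
have h2 : (1 - s) ^+ 2 <= 1 by rewrite expr_le1//; lra.
have := ler_wpM2r (sqr_ge0 `|w - u|) h1.
have := ler_wpM2r (sqr_ge0 `|u - x|) h2.
by rewrite !exprMn in h1 *; lra.
Qed.

End limits_of_solutions.

(** * Convergence of the algorithm *)

Lemma limn_esup_lt_near (R : realType) (u : nat -> R) (l : R) :
  (limn_esup (fun n => (u n)%:E) < l%:E)%E ->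
  exists2 c, c < l & \forall n \near \oo, u n <= c.
Proof.
rewrite /limn_esup limf_esupE => /ereal_inf_lt[s [V Voo <-] sl].
have uV n : V n -> ((u n)%:E <= ereal_sup ((fun n => (u n)%:E) @` V))%E.
  by move=> Vn; apply: ereal_sup_ubound; exists n.
move: sl uV; case: ereal_sup => [c|//|] sl uV.
  by exists c; [rewrite -lte_fin|apply: filterS Voo => n /uV; rewrite lee_fin].
by exists (l - 1); [lra|apply: filterS Voo => n /uV].
Qed.

Theorem theorem4
  (R : realType) (H : completeNormedModType R)
  (ip : {dot H for (@idfun R)}) (ip_norm : induces_norm ip)
  (C : set H) (C_neq0 : C !=set0) (C_closed : closed C) (C_convex : convex_set C)
  (N M : nat)
  (f : 'I_N -> H -> H -> R)
  (f_eq : forall i, equilibrium_bifunction C (f i))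
  (alpha : R) (alpha_gt0 : 0 < alpha)
  (A : 'I_N -> H -> H)
  (A_ism : forall i, inverse_strongly_monotone ip C alpha (A i))
  (kappa : R) (kappa_ge0 : 0 <= kappa) (kappa_lt1 : kappa < 1)
  (S : 'I_M -> H -> H)
  (S_spc : forall j, strictly_pseudocontractive C kappa (S j))
  (F : set H)
  (F_def : F = (\bigcap_i GEP ip C (f i) (A i)) `&`
               (\bigcap_j fixed_points C (S j)))
  (F_neq0 : F !=set0)
  (alpha_ beta_ r_ : nat -> R)
  (alpha_itv : forall n, 0 < alpha_ n < 1)
  (alpha_limsup : (limn_esup (fun n => (alpha_ n)%:E) < 1%:E)%E)
  (b : R) (b_itv : kappa < b < 1)
  (beta_itv : forall n, kappa <= beta_ n <= b)
  (d e : R) (d_gt0 : 0 < d) (e_lt : e < 2 * alpha)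
  (r_itv : forall n, d <= r_ n <= e)
  (x : nat -> H) (y : nat -> 'I_N -> H) (z : nat -> 'I_M -> H)
  (i_ : nat -> 'I_N) (j_ : nat -> 'I_M) (C_ : nat -> set H)
  (x0_C : C (x 0%N))
  (C_0 : C_ 0%N = C)
  (y_def : forall n i,
    y n i = resolvent ip C (f i) (r_ n) (x n - r_ n *: A i (x n)))
  (i_argmax : forall n i, `|y n i - x n| <= `|y n (i_ n) - x n|)
  (z_def : forall n j,
    z n j = alpha_ n *: x n +
            (1 - alpha_ n) *: (beta_ n *: y n (i_ n) +
                               (1 - beta_ n) *: S j (y n (i_ n))))
  (j_argmax : forall n j, `|z n j - x n| <= `|z n (j_ n) - x n|)
  (C_S : forall n,
    C_ n.+1 = [set v | C_ n v /\ `|z n (j_ n) - v| <= `|x n - v|])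
  (x_S : forall n, x n.+1 = metric_projection (C_ n.+1) (x 0%N)) :
  [/\ x @ \oo --> metric_projection F (x 0%N),
      (forall i, (fun n => y n i) @ \oo --> metric_projection F (x 0%N)) &
      (forall j, (fun n => z n j) @ \oo --> metric_projection F (x 0%N))].
Proof.
have CC := convex_set_combination C_convex.
have /andP[_ b1] := b_itv.
have C_P n : closed (C_ n) /\ convex_combination_closed (C_ n).
  by elim: n => [|n [Ccl Cc]]; [rewrite C_0|rewrite C_S; exact: closer_half_space].
have C_sub n : C_ n.+1 `<=` C_ n by move=> v; rewrite C_S => -[].
have C_C n : C_ n `<=` C.
  by elim: n => [|n IH]; [rewrite C_0|exact: subset_trans (C_sub n) IH].
have x_P n : x n = metric_projection (C_ n) (x 0%N).
  by case: n => [|n] //; rewrite C_0 metric_projection_id.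
have r_gt0 n : 0 < r_ n by have := r_itv n; lra.
have y_C n i : C (y n i).
  by rewrite y_def; case: (resolventP ip_norm C_neq0 C_closed C_convex (f_eq i)
    (x n - r_ n *: A i (x n)) (r_gt0 n)).
have F_GEP p i : F p -> GEP ip C (f i) (A i) p by rewrite F_def => -[+ _]; exact.
have F_fix p j : F p -> fixed_points C (S j) p by rewrite F_def => -[_]; exact.
have x_C_ p n : C_ n p -> C_ n (x n).
  have [Ccl Cc] := C_P n; rewrite x_P => Cnp.
  by case: (metric_projectionP ip_norm (x 0%N) (ex_intro _ p Cnp) Ccl Cc).
have step n p i : C (x n) -> F p ->
    `|y n i - p| ^+ 2 + r_ n * (2 * alpha - r_ n) * `|A i (x n) - A i p| ^+ 2 +
      `|y n i - x n + r_ n *: (A i (x n) - A i p)| ^+ 2 <= `|x n - p| ^+ 2.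
  move=> Cx Fp; apply: (resolvent_step ip_norm C_neq0 C_closed C_convex (f_eq i)
    (A_ism i) (r_gt0 n) Cx (F_GEP _ _ Fp)); exact: y_def.
have rr n : 0 < d * (2 * alpha - e) <= r_ n * (2 * alpha - r_ n).
  have /andP[dr re] := r_itv n.
  by apply/andP; split; [apply: mulr_gt0|apply: ler_pM]; lra.
have y_le n p i : C (x n) -> F p -> `|y n i - p| ^+ 2 <= `|x n - p| ^+ 2.
  move=> Cx Fp; have := step n p i Cx Fp.
  have := sqr_ge0 `|y n i - x n + r_ n *: (A i (x n) - A i p)|.
  have : 0 <= r_ n * (2 * alpha - r_ n) * `|A i (x n) - A i p| ^+ 2.
    by rewrite mulr_ge0 ?sqr_ge0//; have := rr n; lra.
  lra.
have z_le n p j : C (x n) -> F p -> `|z n j - p| ^+ 2 <=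
    alpha_ n * `|x n - p| ^+ 2 + (1 - alpha_ n) * `|y n (i_ n) - p| ^+ 2.
  move=> Cx Fp; rewrite z_def (sqnorm_conv ip_norm).
  have /andP[al0 al1] := alpha_itv n.
  have b01 : kappa <= beta_ n <= 1 by have := beta_itv n; lra.
  have := spc_relaxed ip_norm b01 (S_spc j) (F_fix _ j Fp) (y_C n (i_ n)).
  rewrite -(@ler_pM2l _ (1 - alpha_ n)) ?subr_gt0//.
  set w := beta_ n *: _ + _ => h.
  have := sqr_ge0 `|x n - w|.
  have : 0 < alpha_ n * (1 - alpha_ n) by rewrite mulr_gt0// subr_gt0.
  nra.
(* the induction hypothesis makes C_ n nonempty, so that x n is a genuine point
   of C_ n and the one-step estimates apply to it *)
have F_C_ n p : F p -> C_ n p.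
  move=> Fp; elim: n => [|n IH]; first by rewrite C_0; case: (F_GEP p (i_ 0%N) Fp).
  have Cx : C (x n) by exact: C_C (x_C_ _ _ IH).
  rewrite C_S; split=> //; rewrite -(@ler_pXn2r _ 2) ?nnegrE//.
  apply: le_trans (z_le _ _ _ Cx Fp) _.
  have /andP[al0 al1] := alpha_itv n.
  have := y_le _ _ (i_ n) Cx Fp; nra.
have [p0 Fp0] := F_neq0.
have x_C n : C (x n) by exact: C_C (x_C_ _ _ (F_C_ n _ Fp0)).
have [q [xq q_min]] := shrinking_projections ip_norm (fun n => (C_P n).1)
  (fun n => (C_P n).2) C_sub (ex_intro _ p0 (fun n => F_C_ n _ Fp0)) x_P.
have dx0 : (fun n => x n - x n.+1) @ \oo --> (0 : H).
  have xSq : (fun n => x n.+1) @ \oo --> q by rewrite (cvg_shiftS x).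
  by rewrite -(subrr q); exact: cvgB.
have dx2 (k : R) : (fun n => k * `|x n - x n.+1| ^+ 2) @ \oo --> 0.
  rewrite -[0 in X in _ --> X](mulr0 k); apply: cvgM; first exact: cvg_cst.
  have -> : 0 = `|0 : H| ^+ 2 :> R by rewrite normr0 expr0n.
  exact: cvg_sqnorm dx0.
have zx n j : `|z n j - x n| ^+ 2 <= 4 * `|x n - x n.+1| ^+ 2.
  have : C_ n.+1 (x n.+1) by exact: x_C_ (F_C_ n.+1 _ Fp0).
  rewrite {1}C_S => -[_ zx'].
  have sqE (u v : H) : (`|u| <= `|v|) = (`|u| ^+ 2 <= `|v| ^+ 2).
    by rewrite ler_pXn2r ?nnegrE.
  have := j_argmax n j; rewrite sqE => zj.
  rewrite sqE in zx'.
  have := sqnormD_le (z n (j_ n) - x n.+1) (x n.+1 - x n).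
  rewrite addrA subrK (distrC (x n.+1)); lra.
have zq j : (fun n => z n j) @ \oo --> q.
  by apply: cvg_sqdist (dx2 4) _ xq; exact: nearW.
have zbq : (fun n => z n (j_ n)) @ \oo --> q.
  by apply: cvg_sqdist (dx2 4) _ xq; exact: nearW.
(* z n (j_ n) keeps only the weight 1 - alpha_ n >= 1 - a of what y n (i_ n) gains
   in squared distance to p0, so that gain is at most gap n / (1 - a) *)
have [a a_lt1 alpha_a] := limn_esup_lt_near alpha_limsup.
pose gap n := `|x n - p0| ^+ 2 - `|z n (j_ n) - p0| ^+ 2.
have gap0 (k : R) : (fun n => k * gap n) @ \oo --> 0.
  rewrite -[0 in X in _ --> X](mulr0 k); apply: cvgM; first exact: cvg_cst.
  rewrite -(subrr (`|q - p0| ^+ 2)).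
  by apply: cvgB; apply: cvg_sqnorm; apply: cvgB => //; exact: cvg_cst.
pose m := d * (2 * alpha - e); have m0 : 0 < m by have := rr 0%N; rewrite /m; lra.
pose K := (2 + 2 * e ^+ 2 / m) / (1 - a).
have yx : \forall n \near \oo, forall i, `|y n i - x n| ^+ 2 <= K * gap n.
  apply: filterS alpha_a => n alpha_le i.
  have /andP[al0 al1] := alpha_itv n; have /andP[dr re] := r_itv n.
  apply: (@le_trans _ _ (`|y n (i_ n) - x n| ^+ 2)).
    by rewrite ler_pXn2r ?nnegrE.
  have hz := z_le n p0 (j_ n) (x_C n) Fp0.
  have hy := step n p0 (i_ n) (x_C n) Fp0.
  have [_ mr] := andP (rr n).
  have gapE : `|x n - p0| ^+ 2 - `|y n (i_ n) - p0| ^+ 2 <= gap n / (1 - a).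
    rewrite ler_pdivlMr ?subr_gt0// /gap.
    have := y_le n p0 (i_ n) (x_C n) Fp0; rewrite -subr_ge0.
    move=> /ler_wpM2l/(_ _ _ (lerB (lexx 1) alpha_le)); lra.
  have r0e : 0 <= r_ n <= e by rewrite (ltW (r_gt0 n)).
  have disp : m * `|A (i_ n) (x n) - A (i_ n) p0| ^+ 2 +
      `|y n (i_ n) - x n + r_ n *: (A (i_ n) (x n) - A (i_ n) p0)| ^+ 2 <=
      gap n / (1 - a).
    apply: le_trans gapE.
    have := ler_wpM2r (sqr_ge0 `|A (i_ n) (x n) - A (i_ n) p0|) mr.
    rewrite -/m; lra.
  by apply: le_trans (step_displacement m0 r0e disp) _; rewrite /K; lra.
have yq i : (fun n => y n i) @ \oo --> q.
  by apply: cvg_sqdist (gap0 K) _ xq; apply: filterS yx.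
have yb_x : \forall n \near \oo, `|y n (i_ n) - x n| ^+ 2 <= K * gap n.
  by apply: filterS yx => n; exact.
have ybq : (fun n => y n (i_ n)) @ \oo --> q by exact: cvg_sqdist (gap0 K) yb_x xq.
have Syq j : (fun n => S j (y n (i_ n))) @ \oo --> q.
  pose k := ((1 - a) * (1 - b)) ^- 2.
  have w0 : (fun n => k * (2 * `|z n j - x n| ^+ 2 + 2 * `|y n (i_ n) - x n| ^+ 2))
      @ \oo --> 0.
    have -> : 0 = k * (2 * `|q - q| ^+ 2 + 2 * `|q - q| ^+ 2).
      by rewrite subrr normr0 expr0n/= mulr0 addr0 mulr0.
    apply: cvgM; first exact: cvg_cst.
    by apply: cvgD; (apply: cvgM; first exact: cvg_cst);
      apply: cvg_sqnorm; exact: cvgB.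
  apply: cvg_sqdist w0 _ ybq; apply: filterS alpha_a => n alpha_le.
  have /andP[al0 _] := alpha_itv n; have /andP[_ bb] := beta_itv n.
  by apply: relaxed_displacement (z_def n j); rewrite ?alpha_le ?bb ?(ltW al0).
have Fq : F q.
  rewrite F_def; split=> [i _|j _]; last first.
    exact: spc_limit kappa_lt1 (S_spc j) (fun n => y_C n (i_ n)) ybq (Syq j).
  have Cq : C q by apply: (closed_cvg C) xq => //; exact: nearW.
  have Axq : (fun n => A i (x n)) @ \oo --> A i q.
    apply: (@cvg_sqdist _ _ _ (fun=> A i q) (fun n => alpha ^- 2 * `|x n - q| ^+ 2)).
    - have -> : 0 = alpha ^- 2 * `|q - q| ^+ 2.
        by rewrite subrr normr0 expr0n/= mulr0.
      apply: cvgM; first exact: cvg_cst.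
      by apply: cvg_sqnorm; apply: cvgB => //; exact: cvg_cst.
    - apply: nearW => n.
      exact: (ism_lipschitz ip_norm alpha_gt0 (A_ism i) (x_C n) Cq).
    - exact: cvg_cst.
  split=> //.
  apply: (equilibrium_limit ip_norm C_closed C_convex (f_eq i) (fun n => y_C n i)
    (yq i) (w := fun n => A i (x n) + (r_ n)^-1 *: (y n i - x n))).
    apply: (cvg_sqdist (a := fun n => d ^- 2 * `|y n i - x n| ^+ 2)) _ _ Axq.
      have -> : 0 = d ^- 2 * `|q - q| ^+ 2.
        by rewrite subrr normr0 expr0n/= mulr0.
      apply: cvgM; first exact: cvg_cst.
      by apply: cvg_sqnorm; exact: cvgB.
    apply: nearW => n; rewrite [A i _ + _]addrC addrK normrZ exprMn.
    have /andP[dr _] := r_itv n; rewrite ler_wpM2r ?sqr_ge0//.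
    by rewrite ger0_norm ?invr_ge0 ?(ltW (r_gt0 n))// exprVn lef_pV2 ?posrE
      ?exprn_gt0// ler_pXn2r ?nnegrE ?(ltW (r_gt0 n)) ?(ltW d_gt0).
  move=> n v Cv.
  have [_ /(_ _ Cv)] := resolventP ip_norm C_neq0 C_closed C_convex (f_eq i)
    (x n - r_ n *: A i (x n)) (r_gt0 n).
  rewrite -y_def (ipC ip (v - _)) -ipZl.
  have -> // : (r_ n)^-1 *: (y n i - (x n - r_ n *: A i (x n))) =
    A i (x n) + (r_ n)^-1 *: (y n i - x n).
  by rewrite opprB addrCA scalerDr scalerA mulVf ?scale1r// lt0r_neq0.
have -> // : metric_projection F (x 0%N) = q.
by apply: metric_projection_eq => // p Fp; apply: q_min => n; exact: F_C_.
Qed.
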